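(* Let $n \geq 4$ be an integer. Then $B_2(C_n)=3$ if $n=3^u$ or $n=2\cdot 3^u$ for some positive integer $u$; $B_2(C_n)=4$ if $n \neq 3^u$ and $n \neq 2\cdot 3^u$ for every positive integer $u$, and $5 \nmid n$; $B_2(C_n)=5$ if $n=5m$ for some positive integer $m$.
   Context: $C_n$ is the cycle with vertex set $\mathbb{Z}_n=\{0,1,\dots,n-1\}$, $i$ adjacent to $i\pm1 \pmod n$; the graph distance is $\mathrm{dist}(i,j)=\min(|i-j|,\,n-|i-j|)$, and the set of positive distances realized is $\{1,\dots,\lfloor n/2\rfloor\}$. For a set $D$ of positive integers, the distance graph $G(C_n,D)$ has vertex set $\mathbb{Z}_n$, with distinct $i,j$ adjacent iff $\mathrm{dist}(i,j)\in D$; $\chi(C_n,D)$ is its chromatic number. $B_2(C_n)=\max\{\chi(C_n,D): D\subseteq\{1,\dots,\lfloor n/2\rfloor\},\ |D|=2\}$. *)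

(* Defs.v *)
From mathcomp Require Import all_boot all_order all_algebra.

Set Implicit Arguments.
Unset Strict Implicit.
Unset Printing Implicit Defensive.

Record sgraph := SGraph {
  vertex :> finType;
  adj : rel vertex;
  adj_sym : symmetric adj;
  adj_irrefl : irreflexive adj }.

Definition colorable (G : sgraph) (k : nat) : bool :=
  [exists f : {ffun G -> 'I_k},
    [forall x : G, forall y : G, adj x y ==> (f x != f y)]].

Lemma exists_colorable (G : sgraph) : exists k, colorable G k.
Proof.
exists #|G|; apply/existsP; exists [ffun x => enum_rank x].
apply/forallP => x; apply/forallP => y; apply/implyP => xy; rewrite !ffunE.
by apply: contraTneq xy => /enum_rank_inj ->; rewrite adj_irrefl.
Qed.

Definition chromatic_number (G : sgraph) : nat := ex_minn (exists_colorable G).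

(* Graph distance in the cycle C_n on Z_n = {0, ..., n-1}; the absolute value
   is that of the integer difference. *)
Definition cycle_dist (n : nat) (i j : 'I_n) : nat :=
  minn `|i - j| (n - `|i - j|).

Definition cycle_adj (n : nat) (D : pred nat) : rel 'I_n :=
  fun i j => (i != j) && D (cycle_dist i j).

Lemma cycle_adj_sym (n : nat) (D : pred nat) : symmetric (@cycle_adj n D).
Proof. by move=> i j; rewrite /cycle_adj /cycle_dist eq_sym distnC. Qed.

Lemma cycle_adj_irrefl (n : nat) (D : pred nat) : irreflexive (@cycle_adj n D).
Proof. by move=> i; rewrite /cycle_adj eqxx. Qed.

Definition cycle_distance_graph (n : nat) (D : pred nat) : sgraph :=
  SGraph (@cycle_adj_sym n D) (@cycle_adj_irrefl n D).

(* D ranges over the two-element subsets of {1, ..., floor(n/2)}, encoded as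
   subsets of {0, ..., floor(n/2)} that do not contain 0.  The maximum over an
   empty range, which occurs only for n < 4, is 0. *)
Definition B2 (n : nat) : nat :=
  \max_(D : {set 'I_(n./2).+1} | (ord0 \notin D) && (#|D| == 2))
    chromatic_number
      (cycle_distance_graph n [pred d | d \in [seq val a | a in D]]).

(* Main.v *)
(** Colour the vertex [x] by the [k]-th of the circle that contains
    [t * x / n]: the colouring is proper as soon as [t * a / n] and [t * b / n]
    are both at distance at least [1 / k] from the integers.  If [a] and [b]
    have orders [p] and [q] in Z_n with [p / gcd p q] large, [t] can be chosen
    to place [t * b / n] near [1 / 2] first and [t * a / n] afterwards; this
    settles [k = 4] unless [p = q].  When [p = q], [b] is a multiple of [a],
    and an explicit argument on arithmetic progressions modulo [p] gives
    [k = 4] except for [p = 5], where a component is K_5.  When [n] divides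
    [2 * 3 ^ u], the remaining case for [k = 3] has orders with the same 3-part
    and some [t] sends both [a] and [b] to nonzero multiples of [n / 3].
    Conversely, K_3, K_5 and squares of cycles of length prime to 3 occur as
    subgraphs. *)
Require Import Defs.
From mathcomp Require Import all_boot all_order all_algebra.
From mathcomp Require Import zify.

Set Implicit Arguments.
Unset Strict Implicit.
Unset Printing Implicit Defensive.

(** * Colourings from rotations of the circle *)

(* [y / n] is at distance at least [1 / k] from the integers. *)
Definition spread (k n y : nat) : bool :=
  (n <= k * (y %% n)) && (k * (y %% n) + n <= k * n).

Lemma spread_mod k n x y : x = y %[mod n] -> spread k n x = spread k n y.
Proof. by rewrite /spread => ->. Qed.

Lemma spread_small k n y : y < n -> n <= k * y -> k * y + n <= k * n ->
  spread k n y.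
Proof. by move=> yn h1 h2; rewrite /spread modn_small // h1. Qed.

Lemma spread_scale k g n y : 0 < g -> spread k (n * g) (y * g) = spread k n y.
Proof.
move=> g0; rewrite /spread -muln_modl mulnA leq_pmul2r //.
by rewrite [k * (n * g)]mulnA -mulnDl leq_pmul2r.
Qed.

Lemma spread_opp k n x y : 0 < n -> x + y = 0 %[mod n] ->
  spread k n x -> spread k n y.
Proof.
move=> n0; rewrite -modnDm mod0n /spread.
have := ltn_pmod x n0; have := ltn_pmod y n0.
move: (x %% n) (y %% n) => v w wn vn /eqP vw /andP[h1 h2].
have e : v + w = n.
  case/dvdnP: vw => -[|[|c]] e; [|lia|nia].
  by move: e h1; case: v vn h2 => [|v] *; lia.
by apply/andP; split; nia.
Qed.

(** On a circle of length [k], adding [d] moves [k * x / n] by at least 1 and at most [k - 1], so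
    the integer part changes whether or not the move wraps around. *)
Lemma spread_neq_color k n x d : 0 < n -> spread k n d ->
  (k * ((x + d) %% n)) %/ n != (k * (x %% n)) %/ n.
Proof.
move=> n0; rewrite /spread -modnDm.
have := ltn_pmod x n0; have := ltn_pmod d n0.
move: (x %% n) (d %% n) => u v vn un /andP[h1 h2].
have lt y z : k * y + n <= k * z -> (k * y) %/ n < (k * z) %/ n.
  by move=> h; apply: leq_trans (leq_div2r n h); rewrite divnDr // divnn n0 addn1.
have [uv|uv] := ltnP (u + v) n.
  by rewrite modn_small // neq_ltn orbC lt //; nia.
have -> : (u + v) %% n = u + v - n.
  by rewrite -{1}(subnK uv) modnDr modn_small //; lia.
by rewrite neq_ltn lt //; nia.
Qed.

Lemma colorable_spread n k t (D : pred nat) : 0 < n -> 0 < k ->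
  (forall d, D d -> spread k n (t * d)) ->
  colorable (cycle_distance_graph n D) k.
Proof.
move=> n0 k0 hD.
have lt (x : 'I_n) : (k * ((t * x) %% n)) %/ n < k.
  by rewrite ltn_divLR // ltn_pmul2l // ltn_pmod.
apply/existsP; exists [ffun x : 'I_n => Ordinal (lt x)].
have key (x y : 'I_n) : x <= y -> adj (x : cycle_distance_graph n D) y ->
    Ordinal (lt x) != Ordinal (lt y).
  move=> xy /andP[_ Dd]; rewrite -val_eqE /=.
  have yn := ltn_ord y.
  (* The distance is measured along the arc from [x] up to [y], or along the arc from [y] through
     [n] to [x]. *)
  have [e|e] : (x + cycle_dist x y = y) \/ (y + cycle_dist x y = n + x).
    by rewrite /cycle_dist distnEr // /minn; case: ifP; [left|right]; lia.
    by rewrite -e mulnDr eq_sym spread_neq_color // hD.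
  have := @spread_neq_color k n (t * y) _ n0 (hD _ Dd).
  by rewrite -mulnDr e mulnDr modnMDl.
apply/forallP => x; apply/forallP => y; apply/implyP => xy; rewrite !ffunE.
have [le|/ltnW le] := leqP x y; first exact: key.
by rewrite eq_sym key // adj_sym.
Qed.

Lemma chromatic_number_le (G : sgraph) k :
  colorable G k -> chromatic_number G <= k.
Proof. by rewrite /chromatic_number; case: ex_minnP => m _; apply. Qed.

Lemma chromatic_number_gt (G : sgraph) k :
  (forall m (f : G -> 'I_m), m <= k -> (forall x y, adj x y -> f x != f y) -> False) ->
  k < chromatic_number G.
Proof.
rewrite /chromatic_number; case: ex_minnP => m /existsP[f /forallP hf] _ h.
rewrite ltnNge; apply/negP => mk; apply: (h m f mk) => x y xy.
by have /forallP/(_ y)/implyP := hf x; apply.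
Qed.

(** * Congruences and target windows *)

Lemma solve_congruence A p y z : 0 < p ->
  y = z %[mod gcdn A p] -> exists j, y + A * j = z %[mod p].
Proof.
move=> p0; case: (posnP A) => [->|A0]; first by rewrite gcd0n; exists 0; rewrite mul0n addn0.
(* Adding [p * y] keeps the difference of the two sides a true natural subtraction. *)
have yw : y <= z + p * y by nia.
move=> e; have : y = z + p * y %[mod gcdn A p].
  by rewrite e addnC mulnC -modnDml -modnMmr (eqP (dvdn_gcdr A p)) muln0 mod0n.
move=> /esym/eqP; rewrite eqn_mod_dvd // => /dvdnP[c ec].
have [u v uv _] := egcdnP p A0; exists (u * c).
have -> : y + A * (u * c) = z + p * (y + v * c).
  have -> : A * (u * c) = (u * A) * c by nia.
  by rewrite uv; nia.
by rewrite addnC mulnC modnMDl.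
Qed.

Lemma modn_in_window c d y : 0 < d ->
  exists2 z, c <= z < c + d & y = z %[mod d].
Proof.
move=> d0; exists (c + (y + c * d.-1) %% d).
  by rewrite leq_addr /= ltn_add2l ltn_pmod.
rewrite modnDmr; have -> : c + (y + c * d.-1) = c * d + y by case: d d0 => // d _ /=; nia.
by rewrite modnMDl.
Qed.

Lemma half_spread k q : 2 < k -> 1 < q -> spread k q q./2.
Proof.
move=> k3 q2; have e := odd_double_half q; rewrite -muln2 in e.
by apply: spread_small; case: (odd q) e => /= e; nia.
Qed.

(* Fix the residue of [t] modulo [q] so that [t * b] is near [q / 2]; the
   remaining choices of [t] move [t * a] in steps of [gcdn p q], which is at
   most the width of the target window. *)
Lemma spread_pair_window k p q a b : 2 < k -> 0 < p -> 1 < q ->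
    coprime a p -> coprime b q ->
    2 * p + k * gcdn p q <= k * p ->
  exists2 t, spread k p (t * a) & spread k q (t * b).
Proof.
move=> k3 p0 q1 ap bq hw; have q0 := ltnW q1.
have [t0] : exists t0, 0 + b * t0 = q./2 %[mod q].
  by apply: solve_congruence; rewrite // (eqP bq) !modn1.
rewrite add0n => et0.
have d0 : 0 < gcdn p q by rewrite gcdn_gt0 p0.
(* [c] is the ceiling of [p / k], the left end of the target window. *)
have [c c1 c2] : exists2 c, p <= k * c & k * c < p + k.
  have := divn_eq (p + k.-1) k; have := ltn_pmod (p + k.-1) (ltnW (ltnW k3)).
  by move: (_ %/ _) (_ %% _) => c r *; exists c; nia.
have [z /andP[cz zd] ez] := modn_in_window c (t0 * a) d0.
have [j ej] : exists j, t0 * a + q * a * j = z %[mod p].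
  apply: solve_congruence => //.
  by rewrite gcdnC Gauss_gcdl // coprime_sym.
exists (t0 + q * j).
  have -> : (t0 + q * j) * a = t0 * a + q * a * j by nia.
  have k0 : 0 < k by apply: ltnW (ltnW k3).
  have lo : k * c <= k * z by rewrite leq_pmul2l.
  have hi : k * z.+1 <= k * (c + gcdn p q) by rewrite leq_pmul2l.
  rewrite mulnS mulnDr in hi.
  have hz : k * z + p <= k * p by move: hi c2 hw; clear; lia.
  rewrite (spread_mod _ ej); apply: spread_small => //; last exact: leq_trans lo.
  by rewrite -(ltn_pmul2l k0); move: hz p0; clear; lia.
have -> : (t0 + q * j) * b = (j * b) * q + b * t0 by nia.
by rewrite (@spread_mod _ _ _ q./2) ?half_spread // modnMDl.
Qed.

(** * Multiples of one residue, four colours *)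

Lemma Nspread4 m p x : 0 < p -> 4 * m < p + 4 -> p <= 4 * m -> ~~ spread 4 p x ->
  x %% p < m \/ p < x %% p + m.
Proof. by move=> p0 h1 h2; rewrite /spread negb_and => /orP[] h; lia. Qed.

(* With [m = ceil (p / 4)], the good residues form the window [m, p - m].  If
   [m <= s <= p / 2], three consecutive multiples of [s] cannot all avoid it.
   If [1 < s < m], the multiples of [s] cannot jump over it, and those indexed
   by the window cannot all stay in the complementary interval. *)
Lemma spread4_half p s : 1 < p -> p != 5 -> 0 < s -> s.*2 <= p ->
  exists2 t, spread 4 p t & spread 4 p (t * s).
Proof.
move=> p1 p5 s0 sp; have p0 := ltnW p1.
have [m m1 m2] : exists2 m, p <= 4 * m & 4 * m < p + 4.
  have := divn_eq (p + 3) 4; have := ltn_pmod (p + 3) (isT : 0 < 4).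
  by move: (_ %/ _) (_ %% _) => c r *; exists c; nia.
have win t : m <= t -> t + m <= p -> spread 4 p t.
  by move=> *; apply: spread_small; lia.
have [s1|s1] := leqP s 1.
  have -> : s = 1 by lia.
  by exists m; rewrite ?muln1; apply: win; lia.
have nx x : (x + s) %% p = x %% p + s \/ (x + s) %% p + p = x %% p + s.
  rewrite -modnDml; have := ltn_pmod x p0; move: (x %% p) => y yp.
  have [h|h] := ltnP (y + s) p; first by left; rewrite modn_small.
  right; rewrite -{1}(subnK h) modnDr modn_small; lia.
have [ms|sm] := leqP m s.
  (* Excluding [p = 5] puts [m], [m + 1] and [m + 2] all inside the window. *)
  have hp : m.*2 + 2 <= p by lia.
  have [h0|/(Nspread4 p0 m2 m1) h0] := boolP (spread 4 p (m * s)).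
    by exists m; rewrite // win //; lia.
  have [h1|/(Nspread4 p0 m2 m1) h1] := boolP (spread 4 p (m.+1 * s)).
    by exists m.+1; rewrite // win //; lia.
  have [h2|/(Nspread4 p0 m2 m1) h2] := boolP (spread 4 p (m.+2 * s)).
    by exists m.+2; rewrite // win //; lia.
  (* As [4 * m < p + 4], one step [s <= p / 2] cannot jump over the window, while two steps advance
     by at least [2 * m], too far for the bad arc of [2 * m - 1] residues. *)
  exfalso; have := nx (m * s); have := nx (m.+1 * s).
  rewrite -!mulSnr.
  have := ltn_pmod (m * s) p0; have := ltn_pmod (m.+1 * s) p0.
  have := ltn_pmod (m.+2 * s) p0.
  by move: (m * s %% p) (m.+1 * s %% p) (m.+2 * s %% p) h0 h1 h2 => *; lia.
have m3 : 2 < m by lia.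
have [/existsP[t /andP[]]|no] := boolP [exists t : 'I_p, (spread 4 p t) && (spread 4 p (t * s))].
  by exists (val t).
exfalso.
have bad t : m <= t -> t + m <= p -> t * s %% p < m \/ p < t * s %% p + m.
  move=> h1 h2; apply: Nspread4 => //; apply/negP => h3.
  have tp : t < p by lia.
  by move/existsP: no; apply; exists (Ordinal tp); rewrite /= win.
(* Shifting by [m - 1] turns the bad arc around 0 into an initial segment, in which adding [s] never
   wraps. *)
pose v t := (t * s + m.-1) %% p.
have vlt t : m <= t -> t + m <= p -> v t < m.*2.-1.
  move=> h1 h2; rewrite /v -modnDml; case: (bad t h1 h2) => h.
    by rewrite modn_small; lia.
  have l : p <= t * s %% p + m.-1 by lia.
  rewrite -(subnK l) modnDr modn_small; have := ltn_pmod (t * s) p0; lia.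
have vS i : m + i + m <= p -> s * i <= v (m + i).
  elim: i => [|i IH] h; first by rewrite muln0.
  have := IH ltac:(lia); have := vlt (m + i) ltac:(lia) ltac:(lia).
  rewrite /v addnS mulSnr addnAC => h1 h2.
  by have := nx ((m + i) * s + m.-1); nia.
(* Now [s * (p - 2 * m) < 2 * m - 1], which fails for [s >= 2] and [m >= 3]. *)
have := vS (p - m.*2) ltac:(lia); have := vlt (m + (p - m.*2)) ltac:(lia) ltac:(lia).
by nia.
Qed.

(** Being spread is invariant under negation, so the residue of [s] may be replaced by its opposite
    to lie below [p / 2]. *)
Lemma spread4_multiple p s : 1 < p -> p != 5 -> ~~ (p %| s) ->
  exists2 t, spread 4 p t & spread 4 p (t * s).
Proof.
move=> p1 p5 ps; have p0 := ltnW p1.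
have r0 : 0 < s %% p by rewrite lt0n.
have rp := ltn_pmod s p0.
have red t r : r = s %[mod p] -> spread 4 p (t * r) -> spread 4 p (t * s).
  by move=> e; rewrite (@spread_mod _ _ _ (t * s)) // -modnMmr e modnMmr.
have [h|h] := leqP (s %% p).*2 p.
  have [t h1 h2] := spread4_half p1 p5 r0 h; exists t => //.
  by apply: red h2; rewrite modn_mod.
have [||t h1 h2] := @spread4_half p (p - s %% p) p1 p5; [lia|lia|].
exists t => //; apply: spread_opp h2 => //; apply/eqP.
rewrite -mulnDr -modnMmr -modnDmr subnK 1?ltnW // modnn muln0 mod0n //.
Qed.

(** * Two distances of given orders *)

Lemma spread_S k n y : 0 < n -> spread k n y -> spread k.+1 n y.
Proof.
move=> n0; rewrite /spread; have := ltn_pmod y n0.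
by move: (y %% n) => w wn /andP[h1 h2]; rewrite !mulSn; lia.
Qed.

Lemma double_gcd_le p q : 0 < p -> ~~ (p %| q) -> (gcdn p q).*2 <= p.
Proof.
move=> p0 pq; have /dvdnP[[|[|c]] e] := dvdn_gcdl p q; [lia| |].
  by rewrite e mul1n dvdn_gcdr in pq.
by rewrite [X in _ <= X]e -mul2n leq_mul.
Qed.

(** If one order does not divide the other, the gcd is at most half of it and the window argument
    applies. Otherwise [p = q], and an inverse [i] of [a] turns the pair [a], [b] into [1],
    [i * b]. *)
Lemma spread4_orders p q a b : 1 < p -> 1 < q -> coprime a p -> coprime b q ->
    (p != 5) || (q != 5) ->
  exists2 t, spread 4 p (t * a) & spread 4 q (t * b).
Proof.
move=> p1 q1 ap bq pq5; have p0 := ltnW p1; have q0 := ltnW q1.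
have [pq|/(double_gcd_le p0) h] := boolP (p %| q); last first.
  by apply: spread_pair_window => //; lia.
have [qp|/(double_gcd_le q0) h] := boolP (q %| p); last first.
  have [t h1 h2] : exists2 t, spread 4 q (t * b) & spread 4 p (t * a).
    by apply: spread_pair_window => //; lia.
  by exists t.
have e : q = p by apply/eqP; rewrite eqn_dvd qp pq.
subst q; rewrite orbb in pq5.
have [i] : exists i, 0 + a * i = 1 %[mod p].
  by apply: solve_congruence; rewrite // (eqP ap) !modn1.
rewrite add0n => ei.
have ip : coprime i p.
  by have := coprime1n p; rewrite -coprime_modl -ei coprime_modl coprimeMl => /andP[].
have [|t h1 h2] := @spread4_multiple p (i * b) p1 pq5.
  rewrite Gauss_dvdr 1?coprime_sym //; apply/negP => pb.
  by move: bq; rewrite /coprime (gcdn_idPr pb); lia.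
exists (t * i); last by rewrite -mulnA.
rewrite -mulnA (@spread_mod _ _ _ t) // -modnMmr mulnC [i * a]mulnC ei modnMml mul1n //.
Qed.

(** A quotient of an order by [d = gcdn p q] that is at least 3 gives a wide enough window.
    Otherwise both orders are [d] or [2 * d]: either [p = q = 2], or [d = 3 * e] and [t = 2 * e]
    yields the fractions [2 * c / 3] or [c / 3] with [c] prime to 3. *)
Lemma spread3_orders u p q a b : 1 < p -> 1 < q ->
    p %| 2 * 3 ^ u -> q %| 2 * 3 ^ u -> coprime a p -> coprime b q ->
  exists2 t, spread 3 p (t * a) & spread 3 q (t * b).
Proof.
move=> p1 q1 pu qu ap bq; have p0 := ltnW p1; have q0 := ltnW q1.
have d0 : 0 < gcdn p q by rewrite gcdn_gt0 p0.
have /dvdnP[r er] := dvdn_gcdl p q; have /dvdnP[s es] := dvdn_gcdr p q.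
have [r3|r3] := leqP 3 r; first by apply: spread_pair_window => //; nia.
have [s3|s3] := leqP 3 s.
  have [t h1 h2] : exists2 t, spread 3 q (t * b) & spread 3 p (t * a).
    by apply: spread_pair_window => //; rewrite gcdnC; nia.
  by exists t.
have r0 : 0 < r by case: (r) er => //; lia.
have s0 : 0 < s by case: (s) es => //; lia.
have not3 (x y z : nat) : 0 < x -> x < 3 -> z = x * y -> 3 %| z -> 3 %| y.
  by case: x => [|[|[|x]]] //= _ _ -> ; rewrite ?mul1n ?Gauss_dvdr.
have dvd2 z : z %| 2 * 3 ^ u -> ~~ (3 %| z) -> 1 < z -> z = 2.
  move=> zu z3 z1; have : z %| 2.
    by rewrite -(@Gauss_dvdl z 2 (3 ^ u)) // coprime_sym coprimeXl // prime_coprime.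
  by move/dvdn_leq; lia.
have [d3|d3] := boolP (3 %| gcdn p q); last first.
  have hp : p = 2 by apply: dvd2 => //; apply: contra d3; exact: not3 er.
  have hq : q = 2 by apply: dvd2 => //; apply: contra d3; exact: not3 es.
  subst p q; exists 1; rewrite mul1n /spread modn2.
    by move: ap; rewrite coprimen2 => ->.
  by move: bq; rewrite coprimen2 => ->.
have /dvdnP[e ee] := d3.
have e0 : 0 < e by lia.
have main x c z : 0 < x -> x < 3 -> z = x * gcdn p q -> coprime c z ->
    spread 3 z (2 * e * c).
  move=> x0 x3 -> cz.
  have c3 : ~~ (3 %| c).
    rewrite -prime_coprime // coprime_sym; apply: coprime_dvdr cz.
    by rewrite dvdn_mull.
  have c3' : 0 < c %% 3 by rewrite lt0n.
  have c3'' := ltn_pmod c (isT : 0 < 3).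
  rewrite ee; case: x x0 x3 {cz} => [|[|[|x]]] // _ _.
    have -> : 1 * (e * 3) = 3 * e by lia.
    have -> : 2 * e * c = 2 * c * e by nia.
    by rewrite spread_scale // /spread -modnMmr; case: (c %% 3) c3' c3'' => [|[|[|]]].
  have -> : 2 * (e * 3) = 3 * (2 * e) by lia.
  have -> : 2 * e * c = c * (2 * e) by nia.
  by rewrite spread_scale ?muln_gt0 // /spread; case: (c %% 3) c3' c3'' => [|[|[|]]].
by exists (2 * e); [exact: main er ap | exact: main es bq].
Qed.

(** * From distances to their orders in Z_n *)

Lemma reduce_fraction n a : 0 < a -> a < n ->
  exists g p c, [/\ 0 < g, n = p * g, a = c * g, coprime c p & 1 < p].
Proof.
move=> a0 an; have g0 : 0 < gcdn a n by rewrite gcdn_gt0 a0.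
have en := divnK (dvdn_gcdr a n); have ea := divnK (dvdn_gcdl a n).
exists (gcdn a n), (n %/ gcdn a n), (a %/ gcdn a n); split => //.
  rewrite /coprime -(eqn_pmul2r g0) mul1n muln_gcdl ea en //.
move: en ea; move: (n %/ _) (a %/ _) => [|[|x]] y; [lia| |lia].
by case: y => [|y] en ea; nia.
Qed.

Lemma B2_le n k : 0 < n -> 0 < k ->
  (forall p q a b, p %| n -> q %| n -> 1 < p -> 1 < q ->
     coprime a p -> coprime b q ->
     exists2 t, spread k p (t * a) & spread k q (t * b)) ->
  B2 n <= k.
Proof.
move=> n0 k0 hk; apply/bigmax_leqP => D /andP[D0 /cards2P[x [y [xy eD]]]].
apply: chromatic_number_le; subst D.
have bnd (z : 'I_(n./2).+1) : z \in [set x; y] -> (0 < z) && (z < n).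
  move=> zD; have z0 : z != ord0 by apply: contraNneq D0 => <-.
  have : 0 < z by rewrite lt0n; apply: contraNneq z0 => e; apply/eqP/val_inj.
  by have := ltn_ord z; have := odd_double_half n; lia.
have /andP[x0 xn] := bnd x (set21 x y); have /andP[y0 yn] := bnd y (set22 x y).
have [g [p [c [g0 en ex cp p1]]]] := reduce_fraction x0 xn.
have [g' [q [c' [g0' en' ey cq q1]]]] := reduce_fraction y0 yn.
have [||t h1 h2] := hk p q c c' _ _ p1 q1 cp cq.
- by rewrite en dvdn_mulr.
- by rewrite en' dvdn_mulr.
apply: (@colorable_spread _ _ t) => // d /imageP[z /set2P[] -> ->].
  by rewrite [val x]ex mulnA en spread_scale.
by rewrite [val y]ey mulnA en' spread_scale.
Qed.

(** * Lower bounds *)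

Lemma cycle_dist_mod n x a (n0 : 0 < n) : 0 < a -> a.*2 <= n ->
  cycle_dist (Ordinal (ltn_pmod x n0)) (Ordinal (ltn_pmod (x + a) n0)) = a.
Proof.
move=> a0 an; rewrite /cycle_dist /= -modnDml.
have := ltn_pmod x n0; move: (x %% n) => u un.
have [h|h] := ltnP (u + a) n; first by rewrite modn_small // /minn; case: ifP; lia.
have -> : (u + a) %% n = u + a - n.
  by rewrite -{1}(subnK h) modnDr modn_small //; lia.
by rewrite /minn; case: ifP; lia.
Qed.

(** Colourings become [n]-periodic functions on the naturals, which spares later arguments the
    reduction modulo [n]. *)
Lemma B2_gt n k a b : 0 < a -> a < b -> b.*2 <= n ->
  (forall m (h : nat -> 'I_m), m <= k -> (forall x, h (x + n) = h x) ->
     (forall x, h x != h (x + a)) -> (forall x, h x != h (x + b)) -> False) ->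
  k < B2 n.
Proof.
move=> a0 ab bn noh.
have n0 : 0 < n by lia.
have an : a < n./2.+1 by rewrite ltnS geq_half_double; lia.
have bn' : b < n./2.+1 by rewrite ltnS geq_half_double.
pose D := [set Ordinal an; Ordinal bn'].
have hD : (ord0 \notin D) && (#|D| == 2).
  by rewrite !inE cards2 -!val_eqE /=; lia.
rewrite /B2 (bigD1 D) //= leq_max; apply/orP; left.
apply: chromatic_number_gt => m f mk hf.
have key d : 0 < d -> d.*2 <= n -> d \in [seq val i | i in D] -> forall x,
    f (Ordinal (ltn_pmod x n0)) != f (Ordinal (ltn_pmod (x + d) n0)).
  move=> d0 dn dD x; apply: hf; rewrite /= /cycle_adj /= cycle_dist_mod // dD andbT.
  apply/eqP => e; have := cycle_dist_mod x n0 d0 dn.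
  by rewrite -e /cycle_dist distnn; lia.
apply: (noh m (fun x => f (Ordinal (ltn_pmod x n0))) mk).
- by move=> x; congr (f _); apply: val_inj; rewrite /= modnDr.
- by apply: key; [|lia|apply/imageP; exists (Ordinal an); rewrite // !inE eqxx].
- by apply: key; [lia| |apply/imageP; exists (Ordinal bn'); rewrite // !inE eqxx orbT].
Qed.

Lemma uniq_colors m k (s : seq 'I_m) : m <= k -> uniq s -> size s <= k.
Proof.
move=> mk /card_uniqP <-; apply: leq_trans mk; rewrite -[X in _ <= X]card_ord.
exact: max_card.
Qed.

(** The vertices 0, [e], [2 * e] form a triangle; the distance 1 only completes the pair. *)
Lemma B2_ge3 n e : n = 3 * e -> 1 < e -> 2 < B2 n.
Proof.
move=> en e1; apply: (@B2_gt n 2 1 e) => // [|m h m2 hn _ he]; first lia.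
suff /(uniq_colors m2) : uniq [:: h 0; h e; h (2 * e)] by [].
have := he 0; have := he e; have := he (2 * e).
have -> : 2 * e + e = 0 + n by lia.
have -> : e + e = 2 * e by lia.
by rewrite hn add0n /= !inE !negb_or andbT => h20 -> h01; rewrite h01 eq_sym h20.
Qed.

(** The five multiples of [e] form a K_5 for the distances [e] and [2 * e]. *)
Lemma B2_ge5 n e : n = 5 * e -> 0 < e -> 4 < B2 n.
Proof.
move=> en e0; apply: (@B2_gt n 4 e (2 * e)) => // [||m h m4 hn he h2e]; [lia|lia|].
suff /(uniq_colors m4) : uniq [seq h (i * e) | i <- iota 0 5] by [].
have s1 i : h (i * e) != h (i.+1 * e) by have := he (i * e); rewrite -mulSnr.
have s2 i : h (i * e) != h (i.+2 * e) by have := h2e (i * e); rewrite -mulnDl addn2.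
have w i : h (i.+4.+1 * e) = h (i * e).
  by rewrite -(hn (i * e)) en -mulnDl addnC.
have := s1 4; have := s2 4; have := s2 3; rewrite !w => h31 h41 h40.
by rewrite /= !inE !negb_or !s1 !s2 /= [h (0 * e) == h (3 * e)]eq_sym
  [h (0 * e) == h (4 * e)]eq_sym [h (1 * e) == h (4 * e)]eq_sym h31 h41 h40.
Qed.

(* With three colours, a proper colouring of the square of a cycle has period 3. *)
Lemma B2_ge4 n g m : n = m * g -> 0 < g -> 3 < m -> ~~ (3 %| m) -> 3 < B2 n.
Proof.
move=> en g0 m3 hm; apply: (@B2_gt n 3 g (2 * g)) => // [||k h k3 hn hg h2g]; [lia|nia|].
have s1 i : h (i * g) != h (i.+1 * g) by have := hg (i * g); rewrite -mulSnr.
have s2 i : h (i * g) != h (i.+2 * g) by have := h2g (i * g); rewrite -mulnDl addn2.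
have s3 i : h (i.+3 * g) = h (i * g).
  apply/eqP; rewrite eq_sym; apply: contraT => ne.
  suff /(uniq_colors k3) : uniq [seq h (j * g) | j <- iota i 4] by [].
  by rewrite /= !inE !negb_or !s1 !s2 ne.
have per j i : h ((j * 3 + i) * g) = h (i * g).
  by elim: j => // j IH; rewrite mulSn -!addnA !addSn add0n s3.
have hm0 : h (m * g) = h (0 * g) by rewrite -en mul0n -(hn 0).
(* Period 3 and [m] prime to 3 would give vertex 0 the colour of [g] or of [2 * g]. *)
have := ltn_pmod m (isT : 0 < 3).
move: hm; rewrite /dvdn; move: hm0; rewrite [in m * g](divn_eq m 3) per.
case: (m %% 3) => [|[|[|]]] // e _ _; first by have := s1 0; rewrite e eqxx.
by have := s2 0; rewrite e eqxx.
Qed.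

(** * Classification by the primes 3 and 5 *)

Theorem theorem3p3p5 (n : nat) (hn : 4 <= n) :
  [/\ (exists u : nat, 0 < u /\ (n = 3 ^ u \/ n = 2 * 3 ^ u)) -> B2 n = 3,
      (forall u : nat, 0 < u -> n <> 3 ^ u /\ n <> 2 * 3 ^ u) ->
        ~~ (5 %| n) -> B2 n = 4
    & (exists m : nat, 0 < m /\ n = 5 * m) -> B2 n = 5].
Proof.
have n0 : 0 < n by lia.
split.
- move=> [[|u] [// _ nu]]; apply/eqP; rewrite eqn_leq.
  apply/andP; split; last first.
    by case: nu hn => ->; rewrite expnS => hn;
      [apply: (B2_ge3 (e := 3 ^ u))|apply: (B2_ge3 (e := 2 * 3 ^ u))]; lia.
  have nd : n %| 2 * 3 ^ u.+1 by case: nu => -> //; rewrite dvdn_mull.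
  apply: B2_le => // p q a b pn qn p1 q1.
  by apply: (@spread3_orders u.+1) => //; apply: dvdn_trans nd.
- move=> hu n5; apply/eqP; rewrite eqn_leq; apply/andP; split.
    apply: B2_le => // p q a b pn qn p1 q1 ap bq.
    apply: spread4_orders => //; apply/orP; left.
    by apply: contraNneq n5 => <-.
  have [m hm en] := pfactor_coprime (isT : prime 3) n0.
  move: en hm; set u := logn 3 n => en hm.
  apply: (B2_ge4 en); first by rewrite expn_gt0.
    (* The cofactor [m] is [n] itself if [u = 0]; otherwise [m = 1] and [m = 2] are the excluded
       forms, and 3 is not prime to 3. *)
    case: (posnP u) => [u0|u0]; first by move: en; rewrite u0 muln1 => <-.
    have [h1 h2] := hu u u0.
    by case: m hm en => [|[|[|[|]]]] //= _ en; lia.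
  by rewrite -prime_coprime.
- move=> [m [m0 en]]; apply/eqP; rewrite eqn_leq (B2_ge5 en) // andbT.
  apply: B2_le => // p q a b pn qn p1 q1 ap bq.
  have [pq|] := boolP ((p != 5) || (q != 5)).
    have [t h1 h2] := spread4_orders p1 q1 ap bq pq.
    by exists t; apply: spread_S => //; lia.
  rewrite negb_or !negbK => /andP[/eqP ep /eqP eq5]; subst p q.
  (* Every nonzero residue modulo 5 is at least 1/5 of the circle away from 0, so [t = 1] works. *)
  have key c : coprime c 5 -> spread 5 5 (1 * c).
    rewrite coprime_sym prime_coprime // /dvdn /spread mul1n.
    by have := ltn_pmod c (isT : 0 < 5); case: (c %% 5) => [|[|[|[|[|]]]]].
  by exists 1; apply: key.
Qed.
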